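(* Let $B(t,x;123,132)=\sum_{n=0}^{\infty}\sum_{\pi\in\mathfrak{S}_n(123,132)}t^{\mathrm{bdes}(\pi)}x^n$. Then $$B(t,x;123,132)=\frac{1-x+(1-t)x^{2}-(1-t)^{2}x^{3}}{1-2x+(1-t)x^{2}+t(1-t)x^{3}}.$$
   Context: $\mathfrak{S}_n$ is the set of permutations $\pi=\pi_1\pi_2\cdots\pi_n$ of $[n]=\{1,\dots,n\}$ in one-line notation ($\mathfrak{S}_0$ consists of the empty permutation). $\mathfrak{S}_n(123,132)$ is the set of $\pi\in\mathfrak{S}_n$ having no length-three subsequence with the same relative order as $123$ or as $132$. An index $k\in[n-1]$ is a big descent of $\pi\in\mathfrak{S}_n$ if $\pi_k>\pi_{k+1}+1$; $\mathrm{bdes}(\pi)$ is the number of big descents of $\pi$. The identity is one of formal power series in $x$ with coefficients polynomials in $t$. *)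

(* Defs.v *)
From mathcomp Require Import all_boot all_order all_fingroup all_algebra.

Set Implicit Arguments.
Unset Strict Implicit.
Unset Printing Implicit Defensive.

Import GRing.Theory.
Local Open Scope ring_scope.

(* A formal power series over R is the sequence of its coefficients. *)
Definition fps (R : Type) : Type := nat -> R.

Section FormalPowerSeries.

Variable R : comUnitRingType.
Implicit Types a b : fps R.

Definition fps_of_poly (p : {poly R}) : fps R := fun n => p`_n.

Definition fps_mul a b : fps R := fun n => \sum_(i < n.+1) a i * b (n - i)%N.

(* The first n coefficients b_0, ..., b_(n-1) of 1 / a, obtained by solving
   \sum_(i <= m) a_(m-i) b_i = [m = 0] for b_m successively. *)
Fixpoint fps_inv_coefs a (n : nat) : seq R :=
  if n is m.+1 then
    let s := fps_inv_coefs a m in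
    rcons s ((a 0%N)^-1 * ((m == 0%N)%:R - \sum_(i < m) a (m - i)%N * s`_i))
  else [::].

(* This is the inverse of a when a 0 is a unit (fps_mulrV); junk otherwise. *)
Definition fps_inv a : fps R := fun n => (fps_inv_coefs a n.+1)`_n.

Definition fps_div a b : fps R := fps_mul a (fps_inv b).

Lemma size_fps_inv_coefs a n : size (fps_inv_coefs a n) = n.
Proof. by elim: n => //= n IHn; rewrite size_rcons IHn. Qed.

Lemma nth_fps_inv_coefs a n i :
  (i < n)%N -> (fps_inv_coefs a n)`_i = fps_inv a i.
Proof.
elim: n => // n IHn; rewrite ltnS leq_eqVlt => /predU1P[-> // | lt_in].
by rewrite /= nth_rcons size_fps_inv_coefs lt_in IHn.
Qed.

Lemma fps_invE a n :
  fps_inv a n =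
  (a 0%N)^-1 * ((n == 0%N)%:R - \sum_(i < n) a (n - i)%N * fps_inv a i).
Proof.
rewrite {1}/fps_inv /= nth_rcons size_fps_inv_coefs ltnn eqxx.
by under eq_bigr => i _ do rewrite nth_fps_inv_coefs //.
Qed.

Lemma fps_mulrV a :
  a 0%N \is a GRing.unit -> fps_mul a (fps_inv a) =1 fps_of_poly 1.
Proof.
move=> a0_unit n; rewrite /fps_of_poly coef1 /fps_mul.
rewrite (reindex_inj rev_ord_inj) /=.
under eq_bigr => i _ do rewrite subSS (subKn (leq_ord i)).
by rewrite big_ord_recr /= subnn [fps_inv a n]fps_invE mulVKr // addrC subrK.
Qed.

End FormalPowerSeries.

(* Permutations of {0, ..., n-1} stand for permutations of {1, ..., n}; pattern
   containment and big descents are unchanged by this shift. *)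

(* p has a subsequence with the same relative order as the word w. *)
Definition contains_pattern (n : nat) (w : seq nat) (p : 'S_n) : bool :=
  [exists f : {ffun 'I_(size w) -> 'I_n},
     [forall i : 'I_(size w), forall j : 'I_(size w),
        (i < j)%N ==> (f i < f j)%N] &&
     [forall i : 'I_(size w), forall j : 'I_(size w),
        (p (f i) < p (f j))%N == (nth 0 w i < nth 0 w j)%N]].

Definition avoids (n : nat) (ws : seq (seq nat)) (p : 'S_n) : bool :=
  all (fun w => ~~ contains_pattern w p) ws.

Definition big_descent (n : nat) (p : 'S_n) (k : 'I_n) : bool :=
  [exists l : 'I_n, (l == k.+1 :> nat) && (p k > p l + 1)%N].

Definition bdes (n : nat) (p : 'S_n) : nat := #|[set k | big_descent p k]|.

(* B(t, x; ws), with 'X : {poly int} in the role of t. *)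
Definition bdes_gf (ws : seq (seq nat)) : fps {poly int} :=
  fun n => \sum_(p : 'S_n | avoids ws p) 'X ^+ bdes p.

(* Main.v *)
(* A permutation avoids 123 and 132 iff every entry has at most one larger entry
   to its right.  Such a permutation starts with its largest or its second
   largest value, and deleting the first entry leaves an arbitrary such
   permutation.  After deleting the second largest value, the maximum exceeds
   all other values by at least two, so that it is a big descent wherever it is
   not last; hence one also enumerates permutations by the number of big
   descents after raising the maximum.  This yields a linear system of
   recurrences, equivalent to A D = N for the generating function A = N / D. *)
Require Import Defs.
From mathcomp Require Import all_boot all_order all_fingroup all_algebra.
From mathcomp Require Import zify ring.

Set Implicit Arguments.
Unset Strict Implicit.
Unset Printing Implicit Defensive.

Import GRing.Theory.
Local Open Scope ring_scope.

(** * Formal power series: associativity and division *)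

Section FpsTheory.

Variable R : comUnitRingType.
Implicit Types a b c : fps R.

(** Coefficients of a product up to index [n] involve only coefficients up to [n], so truncation
    lets laws of polynomial multiplication carry over to series. *)
Lemma coef_mul_trunc a b n m : (m <= n)%N ->
  (\poly_(i < n.+1) a i * \poly_(i < n.+1) b i)`_m = fps_mul a b m.
Proof.
move=> le_mn; rewrite coefM; apply: eq_bigr => i _.
by rewrite !coef_poly !ifT //; have := ltn_ord i; lia.
Qed.

Lemma fps_mulA a b c : fps_mul a (fps_mul b c) =1 fps_mul (fps_mul a b) c.
Proof.
move=> n; pose T d := \poly_(i < n.+1) (d i : R).
have eqM d e i : (i <= n)%N -> (T (fps_mul d e))`_i = (T d * T e)`_i.
  by move=> le_in; rewrite coef_mul_trunc // coef_poly ltnS le_in.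
rewrite -!(@coef_mul_trunc _ _ n) // -!/(T _).
transitivity (T a * (T b * T c))`_n.
  by rewrite !coefM; apply: eq_bigr => i _; rewrite eqM // leq_subr.
rewrite mulrA [LHS]coefM [RHS]coefM.
by apply: eq_bigr => i _; rewrite eqM // leq_ord.
Qed.

Lemma eq_fps_div a b c :
  b 0%N \is a GRing.unit -> fps_mul a b =1 c -> a =1 fps_div c b.
Proof.
move=> b0_unit abE n.
have /(_ n) : fps_mul a (fps_mul b (fps_inv b)) =1 fps_div c b.
  move=> m; rewrite fps_mulA; apply: eq_bigr => i _; congr (_ * _); exact: abE.
move=> <-; rewrite {1}/fps_mul big_ord_recr /= subnn big1 => [|i _].
  by rewrite (fps_mulrV b0_unit) /fps_of_poly coef1 add0r mulr1.
rewrite (fps_mulrV b0_unit) /fps_of_poly coef1.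
by rewrite subn_eq0 leqNgt ltn_ord mulr0.
Qed.

End FpsTheory.

(** * Avoidance expressed through later larger entries *)

Local Notation patterns := [:: [:: 1; 2; 3]; [:: 1; 3; 2]]%N.

Definition one_later_larger n (p : 'S_n) : bool :=
  [forall i : 'I_n, forall j : 'I_n, forall k : 'I_n,
     [&& i < j, i < k, p i < p j & p i < p k]%N ==> (j == k)].

Lemma one_later_largerP n (p : 'S_n) :
  reflect (forall i j k : 'I_n,
             (i < j)%N -> (i < k)%N -> (p i < p j)%N -> (p i < p k)%N -> j = k)
          (one_later_larger p).
Proof.
apply: (iffP 'forall_forallP) => [h i j k ij ik pij pik | h i j].
  by have /forallP/(_ k) := h i j; rewrite ij ik pij pik => /eqP.
by apply/forallP => k; apply/implyP => /and4P[*]; apply/eqP/(h i).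
Qed.

Lemma contains_pattern3P n (p : 'S_n) (a b c : nat) :
  reflect (exists i j k : 'I_n,
     [/\ (i < j < k)%N, (p i < p j)%N = (a < b)%N, (p i < p k)%N = (a < c)%N,
       (p j < p k)%N = (b < c)%N &
      [/\ (p j < p i)%N = (b < a)%N, (p k < p i)%N = (c < a)%N &
       (p k < p j)%N = (c < b)%N]])
    (contains_pattern [:: a; b; c] p).
Proof.
pose o (m : nat) (lt_m3 : (m < 3)%N) : 'I_(size [:: a; b; c]) := Ordinal lt_m3.
apply: (iffP existsP) => [[f /andP[/'forall_forallP h1 /'forall_forallP h2]] |].
  exists (f (o 0%N isT)), (f (o 1%N isT)), (f (o 2%N isT)).
  have {}h2 i j := eqP (h2 i j).
  split; rewrite ?h2 //.
  rewrite (implyP (h1 (o 0%N isT) (o 1%N isT))) //.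
  by rewrite (implyP (h1 (o 1%N isT) (o 2%N isT))).
move=> [i [j [k [/andP[ij jk] h1 h2 h3 [h4 h5 h6]]]]].
exists [ffun x : 'I_3 => nth i [:: i; j; k] x].
have ik := ltn_trans ij jk.
by apply/andP; split; apply/'forall_forallP => -[[|[|[|//]]] ?] [[|[|[|//]]] ?];
   rewrite !ffunE /= ?ltnn ?ij ?jk ?ik ?h1 ?h2 ?h3 ?h4 ?h5 ?h6 ?eqxx.
Qed.

(** Two later larger entries form 123 or 132 with the given one, according to their relative order;
    conversely each pattern exhibits two such entries. *)
Lemma avoidsE n (p : 'S_n) : avoids patterns p = one_later_larger p.
Proof.
rewrite /avoids /= andbT -negb_or; apply/idP/one_later_largerP => [nC i | h].
  suff lt_case (j k : 'I_n) :
      (j < k)%N -> (i < j)%N -> (p i < p j)%N -> (p i < p k)%N -> False.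
    move=> j k ij ik pij pik; have [jk|kj|/val_inj//] := ltngtP j k.
      by case: (lt_case j k).
    by case: (lt_case k j).
  move=> jk ij pij pik; apply: (negP nC); apply/orP.
  have pjk : p j != p k :> nat.
    by apply: contraTneq jk => /val_inj/perm_inj ->; rewrite ltnn.
  case: (ltnP (p j) (p k)) => cmp; [left | right]; apply/contains_pattern3P;
    exists i, j, k; rewrite ij jk; clear nC; split=> //; by [lia | split; lia].
apply/negP => /orP[] /contains_pattern3P[i [j [k [/andP[ij jk] h1 h2 h3 _]]]];
  have := h i j k ij (ltn_trans ij jk) h1 h2;
  by move: jk => /[swap] ->; rewrite ltnn.
Qed.

(** * Splitting off the first entry *)

Lemma reindex_lift_perm (V : nmodType) n (P : pred 'S_n.+1) (F : 'S_n.+1 -> V) :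
  \sum_(p | P p) F p =
  \sum_(c < n.+1) \sum_(q | P (lift_perm ord0 c q)) F (lift_perm ord0 c q).
Proof.
pose h (u : 'I_n.+1 * 'S_n) := lift_perm ord0 u.1 u.2.
have h_inj : injective h.
  move=> [c q] [d r] /permP eq_h; move: (eq_h ord0).
  rewrite !lift_perm_id /= => eq_cd; subst d; congr (_, _); apply/permP => i.
  by move: (eq_h (lift ord0 i)); rewrite !lift_perm_lift => /lift_inj.
rewrite (reindex h) ?pair_big_dep //=.
apply/onW_bij/(inj_card_bij h_inj).
by rewrite card_prod card_ord !card_Sn factS.
Qed.

Lemma ltn_bump h i j : (bump h i < bump h j)%N = (i < j)%N.
Proof. by rewrite !ltnNge leq_bump2. Qed.

(** A smaller first entry would have both values [n - 1] and [n] larger and to its right. *)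
Lemma one_later_larger_head n (p : 'S_n.+1) :
  one_later_larger p -> (n <= (p ord0).+1)%N.
Proof.
move/one_later_largerP => h; rewrite leqNgt; apply/negP => lt_p0.
have lt_n : (n.-1 < n.+1)%N by lia.
have later_of (d : 'I_n.+1) : (p ord0 < d)%N -> (0 < (p^-1)%g d)%N.
  by rewrite lt0n; apply: contraTneq => d0; rewrite -[d](permKV p)
    (_ : (p^-1)%g d = ord0) ?ltnn //; apply: val_inj.
have /perm_inj/(congr1 val)/= : (p^-1)%g ord_max = (p^-1)%g (inord n.-1).
  by apply: (h ord0); rewrite ?later_of ?permKV //= ?inordK //; lia.
by rewrite inordK //; lia.
Qed.

Lemma one_later_larger_lift n (c : 'I_n.+2) (q : 'S_n.+1) :
  one_later_larger (lift_perm ord0 c q) = (n <= c)%N && one_later_larger q.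
Proof.
apply/idP/andP => [h | [le_nc /one_later_largerP h]].
  split; first by have := one_later_larger_head h; rewrite lift_perm_id.
  move/one_later_largerP: h => h.
  apply/one_later_largerP => i j k ij ik pij pik; apply: (@lift_inj _ ord0).
  by apply: (h (lift ord0 i)); rewrite ?lift_perm_lift /= ?ltn_bump.
apply/one_later_largerP => i j k.
case: (unliftP ord0 j) => [j'|] ->; last by rewrite ltn0.
case: (unliftP ord0 k) => [k'|] ->; last by move=> _; rewrite ltn0.
case: (unliftP ord0 i) => [i'|] -> /=.
  rewrite !lift_perm_lift /= !ltn_bump => ij ik pij pik.
  by rewrite (h i' j' k').
(* Only [n + 1] can exceed a first value [c >= n], so both later larger entries have this value. *)
rewrite lift_perm_id !lift_perm_lift /= /bump => _ _ ltj ltk.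
congr (lift _ _); apply/(@perm_inj _ q)/val_inj => /=.
have := ltn_ord (q j'); have := ltn_ord (q k'); lia.
Qed.

Lemma sum_one_later_larger (V : nmodType) n (F : 'S_n.+2 -> V) :
  \sum_(p | one_later_larger p) F p =
  \sum_(q | one_later_larger q)
    (F (lift_perm ord0 (inord n) q) + F (lift_perm ord0 ord_max q)).
Proof.
rewrite reindex_lift_perm big_ord_recr /= big_ord_recr /= big1 => [|c _].
  rewrite add0r big_split; congr (_ + _); last first.
    by apply: eq_bigl => q; rewrite one_later_larger_lift /= leqnSn.
  have -> : widen_ord (leqnSn n.+1) ord_max = inord n.
    by apply/val_inj; rewrite /= inordK.
  by apply: eq_bigl => q; rewrite one_later_larger_lift inordK ?leqnn.
by apply: big_pred0 => q; rewrite one_later_larger_lift /= leqNgt ltn_ord.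
Qed.

(** * Effect of a new first entry on big descents *)

(* Big descents after adding r to the entry of p with the largest value, n.-1. *)
Definition big_descent_raise r n (p : 'S_n) (k : 'I_n) : bool :=
  [exists l : 'I_n, (l == k.+1 :> nat)
    && (p l + 1 < p k + (p k == n.-1 :> nat) * r)%N].

Definition bdes_raise r n (p : 'S_n) : nat :=
  \sum_(k < n) big_descent_raise r p k.

Lemma bdes_raise0 n (p : 'S_n) : bdes_raise 0 p = bdes p.
Proof.
rewrite /bdes -sum1_card big_mkcond; apply: eq_bigr => k _ /=.
rewrite inE /big_descent_raise /big_descent.
under eq_existsb => l do rewrite muln0 addn0.
by case: ifP => // ->.
Qed.

Lemma big_descent_raise_liftS r n (c : 'I_n.+1) (q : 'S_n) k :
  big_descent_raise r (lift_perm ord0 c q) (lift ord0 k) =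
  [exists l : 'I_n, (l == k.+1 :> nat)
    && (bump c (q l) + 1 < bump c (q k) + (bump c (q k) == n) * r)%N].
Proof.
apply/existsP/existsP => -[l].
  case: (unliftP ord0 l) => [l'|] -> //.
  by rewrite !lift_perm_lift /= => lP; exists l'.
by move=> lP; exists (lift ord0 l); rewrite !lift_perm_lift.
Qed.

Lemma big_descent_raise_lift0 r n (c : 'I_n.+2) (q : 'S_n.+1) :
  big_descent_raise r (lift_perm ord0 c q) ord0 =
  (bump c (q ord0) + 1 < c + (c == n.+1 :> nat) * r)%N.
Proof.
apply/existsP/idP => [[l] | lt_c].
  case: (unliftP ord0 l) => [l'|] -> //.
  rewrite lift_perm_lift lift_perm_id /= => /andP[/eqP[l'0]].
  by rewrite (_ : l' = ord0) //; apply: val_inj.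
by exists (lift ord0 ord0); rewrite lift_perm_lift lift_perm_id.
Qed.

(** The raise moves to the new maximum in front; the old entries keep their values and lose it. *)
Lemma bdes_raise_lift_max r n (q : 'S_n.+1) :
  bdes_raise r (lift_perm ord0 ord_max q) =
  ((q ord0 + 1 < n.+1 + r) + bdes_raise 0 q)%N.
Proof.
have bumpE (i : 'I_n.+1) : bump n.+1 i = i.
  by rewrite /bump leqNgt ltn_ord add0n.
rewrite /bdes_raise big_ord_recl big_descent_raise_lift0 /= bumpE eqxx mul1n.
congr (_ + _)%N; apply: eq_bigr => k _; rewrite big_descent_raise_liftS.
congr nat_of_bool; apply: eq_existsb => l.
by rewrite !bumpE (ltn_eqF (ltn_ord _)) muln0.
Qed.

(** Inserting the value [n] shifts the old maximum from [n] to [n + 1], just as a raise by 1 does.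
    It is then at least two above every old entry, so a further raise [r] changes nothing. *)
Lemma bdes_raise_lift_second r n (q : 'S_n.+1) :
  one_later_larger q ->
  bdes_raise r (lift_perm ord0 (inord n) q) = bdes_raise 1 q.
Proof.
move=> /one_later_larger_head q0_ge; rewrite /bdes_raise big_ord_recl.
rewrite big_descent_raise_lift0 inordK // (ltn_eqF (ltnSn n)) addn0.
(* The next entry is at least [n - 1], so the head [n] is no big descent. *)
rewrite [(_ < _)%N]negbTE ?add0n; last by rewrite /bump; lia.
apply: eq_bigr => k _; rewrite big_descent_raise_liftS.
congr nat_of_bool; apply: eq_existsb => l; rewrite inordK //.
case: eqP => //= lk.
have /eqP : q l != q k :> nat.
  by apply/eqP => /val_inj/perm_inj eq_lk; move: lk; rewrite eq_lk; lia.
have := ltn_ord (q l); have := ltn_ord (q k); rewrite /bump; lia.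
Qed.

(** * Linear recurrences for the generating polynomials *)

Definition bdes_sum r n : {poly int} :=
  \sum_(p : 'S_n.+1 | one_later_larger p) 'X ^+ bdes_raise r p.

(* Enumerates the permutations of size n + 2 that start with their maximum. *)
Definition bdes_sum_max n : {poly int} :=
  \sum_(p : 'S_n.+1 | one_later_larger p)
    'X ^+ bdes_raise 0 (lift_perm ord0 ord_max p).

Lemma bdes_sum_rec n : bdes_sum 0 n.+1 = bdes_sum 1 n + bdes_sum_max n.
Proof.
rewrite /bdes_sum sum_one_later_larger -big_split; apply: eq_bigr => q q_ok /=.
by rewrite bdes_raise_lift_second.
Qed.

(** A raised maximum in front is always a big descent, whence the factor ['X]. *)
Lemma bdes_sum_raised_rec n : bdes_sum 1 n.+1 = bdes_sum 1 n + 'X * bdes_sum 0 n.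
Proof.
rewrite /bdes_sum sum_one_later_larger big_distrr -big_split.
apply: eq_bigr => q q_ok /=.
rewrite bdes_raise_lift_second // bdes_raise_lift_max -exprS.
by rewrite (_ : (_ < _)%N) ?add1n //; have := ltn_ord (q ord0); lia.
Qed.

(** Split by the entry after the leading maximum [n + 2]: the value [n] makes a big descent, the
    value [n + 1] does not. *)
Lemma bdes_sum_max_rec n : bdes_sum_max n.+1 = 'X * bdes_sum 1 n + bdes_sum_max n.
Proof.
rewrite /bdes_sum_max sum_one_later_larger /bdes_sum big_distrr -big_split.
apply: eq_bigr => q q_ok /=; rewrite !(bdes_raise_lift_max 0 (lift_perm _ _ _)).
rewrite bdes_raise_lift_second // !lift_perm_id inordK //= -exprS.
by rewrite !addn0 !addn1 ltnSn ltnn bdes_raise_lift_max addn0 addn1 add0n add1n.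
Qed.

(** * Initial values and elimination of the auxiliary sums *)

Lemma sum_S1 (V : nmodType) (F : 'S_1 -> V) :
  \sum_(p | one_later_larger p) F p = F 1%g.
Proof.
rewrite (big_pred1 1%g) // => p; rewrite [p]permS1 /= eqxx.
by apply/one_later_largerP => i j k; rewrite !ord1.
Qed.

Lemma bdes_raise_S1 r (p : 'S_1) : bdes_raise r p = 0%N.
Proof.
rewrite /bdes_raise big_ord1 (_ : big_descent_raise _ _ _ = false) //.
by apply/negbTE/existsPn => l; rewrite ord1.
Qed.

Lemma bdes_sum0 r : bdes_sum r 0 = 1.
Proof. by rewrite /bdes_sum sum_S1 bdes_raise_S1. Qed.

Lemma bdes_sum_max0 : bdes_sum_max 0 = 1.
Proof.
by rewrite /bdes_sum_max sum_S1 bdes_raise_lift_max bdes_raise_S1 perm1.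
Qed.

Lemma bdes_gf0 : bdes_gf patterns 0 = 1.
Proof.
rewrite /bdes_gf (big_pred1 1%g) => [|p]; last first.
  by rewrite avoidsE [p]permS0 /= eqxx; apply/one_later_largerP => -[].
by rewrite -bdes_raise0 /bdes_raise big_ord0.
Qed.

Lemma bdes_gfS n : bdes_gf patterns n.+1 = bdes_sum 0 n.
Proof.
apply: eq_big => [p | p _]; first exact: avoidsE.
by rewrite bdes_raise0.
Qed.

(** Unfolding the recurrences writes all four terms through the three sums at index [n]. The empty
    permutation is outside this system, so the smallest size involved is 1. *)
Lemma bdes_gf_rec n :
  bdes_gf patterns n.+4 = 2%:R * bdes_gf patterns n.+3
    - (1 - 'X) * bdes_gf patterns n.+2 - 'X * (1 - 'X) * bdes_gf patterns n.+1.
Proof.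
by rewrite !bdes_gfS !(bdes_sum_rec, bdes_sum_max_rec, bdes_sum_raised_rec); ring.
Qed.

Lemma bdes_gf_init :
  [/\ bdes_gf patterns 1 = 1, bdes_gf patterns 2 = 2%:R &
      bdes_gf patterns 3 = 2%:R * (1 + 'X)].
Proof.
by split; rewrite bdes_gfS !(bdes_sum_rec, bdes_sum_max_rec,
  bdes_sum_raised_rec, bdes_sum0, bdes_sum_max0); ring.
Qed.

Theorem theorem3p5 :
  let t : {poly int} := 'X in
  let x : {poly {poly int}} := 'X in
  bdes_gf [:: [:: 1; 2; 3]; [:: 1; 3; 2]]%N =1
  fps_div
    (fps_of_poly
       (1 - x + (1 - t) *: x ^+ 2 - (1 - t) ^+ 2 *: x ^+ 3))
    (fps_of_poly
       (1 - 2%:R *: x + (1 - t) *: x ^+ 2 + (t * (1 - t)) *: x ^+ 3)).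
Proof.
move=> t x; set N := (X in fps_div (fps_of_poly X)).
set D := (X in fps_div _ (fps_of_poly X)).
have coef_num i : N`_i = nth 0 [:: 1; - 1; 1 - t; - (1 - t) ^+ 2] i.
  rewrite !(coefB, coefD, coefZ, coefXn, coefX, coef1).
  by case: i => [|[|[|[|i]]]] /=; rewrite ?nth_nil; ring.
have coef_den i : D`_i = nth 0 [:: 1; - 2%:R; 1 - t; t * (1 - t)] i.
  rewrite !(coefB, coefD, coefZ, coefXn, coefX, coef1).
  by case: i => [|[|[|[|i]]]] /=; rewrite ?nth_nil; ring.
clearbody N D; have [gf1 gf2 gf3] := bdes_gf_init.
apply: eq_fps_div => [|n]; first by rewrite /fps_of_poly coef_den unitr1.
rewrite /fps_mul /fps_of_poly coef_num; under eq_bigr do rewrite coef_den.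
case: n => [|[|[|[|n]]]].
(* Indices 0 to 3, where the numerator is supported, come from the initial values. *)
1-4: by rewrite !big_ord_recr big_ord0 /= ?(bdes_gf0, gf1, gf2, gf3) -/t; ring.
(* The denominator has degree at most 3, so only the last four terms of the convolution survive;
   they cancel by the recurrence. *)
do 4!rewrite big_ord_recr /=; rewrite subnn subSnn big1 => [|i _]; last first.
  rewrite nth_default ?mulr0 //=.
  by rewrite ltn_subRL addn3 !ltnS leq_ord.
rewrite (addnK n.+1 3) (addnK n.+2 2).
by rewrite nth_nil bdes_gf_rec -/t /=; ring.
Qed.
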